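(* Let $R$ be a left Noetherian and left hereditary ring, let $A$ be a distributive left $R$-module, and let $I_{0},\ldots,I_{n}$ be injective submodules of $A$. Then for all $q\geq 0$, as functors of left $R$-modules, $${\rm Ext}^{q}_{R}(-,\, I_{0}\cap\cdots\cap I_{n})={\rm H}^{q}\big({\rm Hom}_{R}(-,{\rm C}^{\bullet}(I_{0},\ldots,I_{n}))\big),$$ where the complex ${\rm C}^{\bullet}(I_0,\ldots,I_n)$ of $R$-modules is defined in the context. Therefore, if (in this situation) $A$ is a finitely generated and non-singular module over a Dedekind ring $R$, then $${\rm H}^{q}\big({\rm Hom}_{R}(-,{\rm C}^{\bullet}(I_{0},\ldots,I_{n}))\big)=0\qquad\text{for } q>0.$$
   Context: A module is distributive if its lattice of submodules (with meet $\cap$ and join $+$) is distributive, i.e. $I_0+(I_1\cap I_2)=(I_0+I_1)\cap(I_0+I_2)$ for all submodules $I_0,I_1,I_2$. A left module is non-singular if it has no nonzero element annihilated by an essential left ideal of $R$. Equality of functors means natural isomorphism. For submodules $I_0,\ldots,I_n$ of $A$ and $q\geq 0$, ${\rm C}^{q}(I_0,\ldots,I_n)$ is the submodule of $$\prod_{0\leq\alpha_0,\ldots,\alpha_q\leq n}(I_{\alpha_0}+\cdots+I_{\alpha_q})$$ consisting of the families $(i_{\alpha_0\ldots\alpha_q})$ that are completely alternating in the indices, i.e. $i_{\alpha_0\ldots\alpha_q}$ changes sign when two indices are interchanged and is $0$ when two indices are equal. (Thus ${\rm C}^q$ can be identified with $\prod_{0\leq\alpha_0<\cdots<\alpha_q\leq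 n}(I_{\alpha_0}+\cdots+I_{\alpha_q})$.) The coboundary operator $d:{\rm C}^{q}(I_0,\ldots,I_n)\to{\rm C}^{q+1}(I_0,\ldots,I_n)$ is $$(di)_{\alpha_0\ldots\alpha_{q+1}}=\sum_{p=0}^{q+1}(-1)^p\, i_{\alpha_0\ldots\widehat{\alpha_p}\ldots\alpha_{q+1}},$$ where the hat denotes omission; one has $d\circ d=0$. *)

(* Defs.v *)
From HB Require Import structures.
From mathcomp Require Import all_boot all_order all_fingroup all_algebra.
From mathcomp Require Import boolp finmap.
From mathcomp Require Import zify.
From mathcomp.multinomials Require Import monalg.

Set Implicit Arguments.
Unset Strict Implicit.
Unset Printing Implicit Defensive.

Import GRing.Theory.
Local Open Scope ring_scope.
Local Open Scope quotient_scope.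

(* Rings are pzRingType (unital, not necessarily commutative, possibly zero)
   and an lmodType R is a left R-module.  A submodule of A is a term of type
   submodClosed A, i.e. a bool-valued predicate on A with closure proofs; by
   boolp every Prop-valued submodule is of this form. *)

Section Submodules.
Variables (R : pzRingType) (A : lmodType R).

Section SubModType.
Variable I : submodClosed A.

Record submod := Submod { submod_val : A; submod_valP : submod_val \in I }.

HB.instance Definition _ := [isSub for submod_val].
HB.instance Definition _ := [Choice of submod by <:].
HB.instance Definition _ := [SubChoice_isSubLmodule of submod by <:].
End SubModType.

Section Binary.
Variables I J : submodClosed A.

Definition cap_pred : {pred A} := [pred x | (x \in I) && (x \in J)].
Definition add_pred : {pred A} :=
  [pred x | `[< exists y z, [/\ y \in I, z \in J & x = y + z] >]].

Fact cap_pred_closed : submod_closed cap_pred.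
Proof.
split=> [|a x y]; first by rewrite inE !rpred0.
by rewrite !inE => /andP[xI xJ] /andP[yI yJ]; rewrite !rpredD ?rpredZ.
Qed.

Fact add_pred_closed : submod_closed add_pred.
Proof.
split=> [|a x y].
  by apply/asboolP; exists 0, 0; rewrite !rpred0 addr0.
move=> /asboolP[u [v [uI vJ ->]]] /asboolP[w [t [wI tJ ->]]]; apply/asboolP.
exists (a *: u + w), (a *: v + t); split; rewrite ?rpredD ?rpredZ //.
by rewrite scalerDr addrACA.
Qed.

HB.instance Definition _ :=
  GRing.isSubmodClosed.Build R A cap_pred cap_pred_closed.
HB.instance Definition _ :=
  GRing.isSubmodClosed.Build R A add_pred add_pred_closed.

Definition capsm : submodClosed A := cap_pred.
Definition addsm : submodClosed A := add_pred.
End Binary.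

Section Families.
Variables (k : nat) (I : 'I_k -> submodClosed A).

Definition bigcap_pred : {pred A} := [pred x | [forall j, x \in I j]].
Definition bigadd_pred : {pred A} :=
  [pred x | `[< exists2 y : 'I_k -> A,
                  forall j, y j \in I j & x = \sum_(j < k) y j >]].

Fact bigcap_pred_closed : submod_closed bigcap_pred.
Proof.
split=> [|a x y]; first by apply/forallP=> j; apply: rpred0.
move=> /forallP xI /forallP yI; apply/forallP=> j.
by rewrite rpredD ?rpredZ ?xI ?yI.
Qed.

Fact bigadd_pred_closed : submod_closed bigadd_pred.
Proof.
split=> [|a x y].
  apply/asboolP; exists (fun=> 0) => [j|]; first exact: rpred0.
  by rewrite big1.
move=> /asboolP[u uI ->] /asboolP[v vI ->]; apply/asboolP.
exists (fun j => a *: u j + v j) => [j|].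
  by rewrite rpredD ?rpredZ ?uI ?vI.
by rewrite scaler_sumr big_split.
Qed.

HB.instance Definition _ :=
  GRing.isSubmodClosed.Build R A bigcap_pred bigcap_pred_closed.
HB.instance Definition _ :=
  GRing.isSubmodClosed.Build R A bigadd_pred bigadd_pred_closed.

Definition bigcapsm : submodClosed A := bigcap_pred.
Definition bigaddsm : submodClosed A := bigadd_pred.
End Families.

Definition distributive_module :=
  forall I0 I1 I2 : submodClosed A,
    addsm I0 (capsm I1 I2) =i capsm (addsm I0 I1) (addsm I0 I2).

End Submodules.

Section ModuleProperties.
Variable R : pzRingType.

Definition fin_gen_module (M : lmodType R) :=
  exists s : seq M, forall x : M,
    exists c : 'I_(size s) -> R, x = \sum_(j < size s) c j *: s`_j.

Definition projective_module (P : lmodType R) :=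
  forall (M N : lmodType R) (f : {linear M -> N}) (g : {linear P -> N}),
    (forall y, exists x, f x = y) ->
    exists h : {linear P -> M}, forall x, f (h x) = g x.

Definition injective_module (E : lmodType R) :=
  forall (M N : lmodType R) (f : {linear M -> N}) (g : {linear M -> E}),
    injective f -> exists h : {linear N -> E}, forall x, h (f x) = g x.

Definition essential_left_ideal (L : submodClosed R^o) :=
  forall K : submodClosed R^o,
    (exists2 r, r \in K & r != 0) -> exists r, [/\ r \in L, r \in K & r != 0].

Definition nonsingular_module (M : lmodType R) :=
  forall (x : M) (L : submodClosed R^o),
    essential_left_ideal L -> (forall r : R, r \in L -> r *: x = 0) -> x = 0.

End ModuleProperties.

(* The left ideals of R are the submodules of R^o. *)
Definition left_noetherian (R : pzRingType) :=
  forall L : submodClosed R^o, fin_gen_module (submod L).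

Definition left_hereditary (R : pzRingType) :=
  forall L : submodClosed R^o, projective_module (submod L).

(* Dedekind rings, in the generality suited to a noncommutative R: hereditary
   Noetherian prime rings, on both sides, in which every nonzero two-sided
   ideal is invertible in the classical (Goldie) quotient ring.  For
   commutative R these are exactly the Dedekind domains, fields included. *)
Section Dedekind.
Variable R : pzRingType.

Definition prime_ring :=
  (1 != 0 :> R) /\
  forall a b : R, (forall r, a * r * b = 0) -> a = 0 \/ b = 0.

Definition regular_elt (s : R) :=
  forall x : R, (s * x = 0 -> x = 0) /\ (x * s = 0 -> x = 0).

Definition classical_quotient_ring (Q : unitRingType)
    (iota : {rmorphism R -> Q}) :=
  [/\ injective iota,
      forall s, regular_elt s -> iota s \is a GRing.unit,
      forall q, exists s r, regular_elt s /\ q = (iota s)^-1 * iota r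
    & forall q, exists s r, regular_elt s /\ q = iota r * (iota s)^-1].

Definition two_sided (L : submodClosed R^o) :=
  forall x r : R, x \in L -> x * r \in L.

(* J J' = J' J = R for some R-R-subbimodule J' of Q, products of additive
   subgroups being the sets of finite sums of products. *)
Definition invertible_ideal (Q : unitRingType) (iota : {rmorphism R -> Q})
    (J : submodClosed R^o) :=
  exists J' : Q -> Prop,
    [/\ [/\ J' 0, forall x y, J' x -> J' y -> J' (x + y),
            forall r x, J' x -> J' (iota r * x)
          & forall r x, J' x -> J' (x * iota r)],
        forall a x, a \in J -> J' x ->
          (exists r, iota a * x = iota r) /\ (exists r, x * iota a = iota r),
        exists (k : nat) (a : 'I_k -> R) (x : 'I_k -> Q),
          (forall i, a i \in J /\ J' (x i)) /\
          1 = \sum_(i < k) iota (a i) * x i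
      & exists (k : nat) (a : 'I_k -> R) (x : 'I_k -> Q),
          (forall i, a i \in J /\ J' (x i)) /\
          1 = \sum_(i < k) x i * iota (a i)].

End Dedekind.

Definition dedekind_ring (R : pzRingType) :=
  [/\ left_noetherian R /\ left_noetherian R^c,
      left_hereditary R /\ left_hereditary R^c,
      prime_ring R
    & exists (Q : unitRingType) (iota : {rmorphism R -> Q}),
        classical_quotient_ring iota /\
        forall J : submodClosed R^o, two_sided J ->
          (exists2 x, x \in J & x != 0) -> invertible_ideal iota J].

Section Hom.
Variables (R : pzRingType) (M N : lmodType R).

Definition hom : Type := {linear M -> N}.

HB.instance Definition _ := gen_eqMixin hom.
HB.instance Definition _ := gen_choiceMixin hom.

Lemma homP (f g : hom) : (forall x, f x = g x) -> f = g.
Proof.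
case: f g => [f cf] [g cg] /= /funext fg; subst g; congr GRing.Linear.Pack.
case: cf cg => [[a] [b]] [[c] [d]] /=.
by rewrite (Prop_irrelevance a c) (Prop_irrelevance b d).
Qed.

Definition hom_zero : hom := (\0 : {linear M -> N}).
Definition hom_opp (f : hom) : hom := (\- f : {linear M -> N}).
Definition hom_add (f g : hom) : hom := (f \+ g : {linear M -> N}).

Fact hom_addA : associative hom_add.
Proof. by move=> f g h; apply: homP => x /=; rewrite addrA. Qed.
Fact hom_addC : commutative hom_add.
Proof. by move=> f g; apply: homP => x /=; rewrite addrC. Qed.
Fact hom_add0 : left_id hom_zero hom_add.
Proof. by move=> f; apply: homP => x /=; rewrite add0r. Qed.
Fact hom_addN : left_inverse hom_zero hom_opp hom_add.
Proof. by move=> f; apply: homP => x /=; rewrite addNr. Qed.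

HB.instance Definition _ :=
  GRing.isZmodule.Build hom hom_addA hom_addC hom_add0 hom_addN.

Lemma hom0E x : (0 : hom) x = 0. Proof. by []. Qed.
Lemma homNE (f : hom) x : (- f) x = - f x. Proof. by []. Qed.
Lemma homDE (f g : hom) x : (f + g) x = f x + g x. Proof. by []. Qed.
End Hom.

Section HomMaps.
Variable R : pzRingType.

Definition precomp (M M' N : lmodType R) (f : {linear M -> M'})
  (g : hom M' N) : hom M N := (g \o f : {linear M -> N}).
Definition postcomp (M N N' : lmodType R) (f : {linear N -> N'})
  (g : hom M N) : hom M N' := (f \o g : {linear M -> N'}).

Lemma precompE (M M' N : lmodType R) (f : {linear M -> M'}) (g : hom M' N) x :
  precomp f g x = g (f x).
Proof. by []. Qed.
Lemma postcompE (M N N' : lmodType R) (f : {linear N -> N'}) (g : hom M N) x :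
  postcomp f g x = f (g x).
Proof. by []. Qed.

Fact precomp_additive (M M' N : lmodType R) (f : {linear M -> M'}) :
  zmod_morphism (@precomp M M' N f).
Proof. by move=> g h; apply: homP. Qed.
Fact postcomp_additive (M N N' : lmodType R) (f : {linear N -> N'}) :
  zmod_morphism (@postcomp M N N' f).
Proof. by move=> g h; apply: homP => x; apply: raddfB. Qed.

HB.instance Definition _ (M M' N : lmodType R) (f : {linear M -> M'}) :=
  GRing.isZmodMorphism.Build (hom M' N) (hom M N) (@precomp M M' N f)
    (precomp_additive f).
HB.instance Definition _ (M N N' : lmodType R) (f : {linear N -> N'}) :=
  GRing.isZmodMorphism.Build (hom M N) (hom M N') (@postcomp M N N' f)
    (postcomp_additive f).
End HomMaps.

Record cochain := Cochain {
  cgrp :> nat -> zmodType;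
  cdiff : forall q, {additive cgrp q -> cgrp q.+1};
  cdiffK : forall q x, cdiff q.+1 (cdiff q x) = 0 }.

Record cochain_map (X Y : cochain) := CochainMap {
  cmap :> forall q, {additive X q -> Y q};
  cmapE : forall q x, cmap q.+1 (cdiff X q x) = cdiff Y q (cmap q x) }.

Definition is_coboundary (X : cochain) (q : nat) : X q -> Prop :=
  match q return X q -> Prop with
  | 0 => fun x => x = 0
  | p.+1 => fun x => exists y : X p, x = cdiff X p y
  end.

Fact is_coboundary0 (X : cochain) q : is_coboundary (0 : X q).
Proof. by case: q => //= p; exists 0; rewrite raddf0. Qed.
Fact is_coboundaryB (X : cochain) q (x y : X q) :
  is_coboundary x -> is_coboundary y -> is_coboundary (x - y).
Proof.
case: q x y => [|p] x y /=; first by move=> -> ->; rewrite subr0.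
by move=> [u ->] [v ->]; exists (u - v); rewrite raddfB.
Qed.
Fact is_coboundary_map (X Y : cochain) (f : cochain_map X Y) q (x : X q) :
  is_coboundary x -> is_coboundary (f q x).
Proof.
case: q x => [|p] x /=; first by move=> ->; rewrite raddf0.
by move=> [u ->]; exists (f p u); rewrite cmapE.
Qed.

(* cohomology X q is ker (cdiff X q) modulo the image of cdiff X (q - 1), the
   latter being 0 for q = 0. *)
Section Cohomology.
Variables (X : cochain) (q : nat).

Definition cocycle_pred : {pred X q} := [pred x | cdiff X q x == 0].
Fact cocycle_closed : zmod_closed cocycle_pred.
Proof.
split=> [|x y]; first by rewrite inE raddf0.
by rewrite !inE => /eqP dx /eqP dy; rewrite raddfB dx dy subrr.
Qed.
HB.instance Definition _ :=
  GRing.isZmodClosed.Build (X q) cocycle_pred cocycle_closed.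

Record cocycle := Cocycle { coc_val : X q; coc_valP : coc_val \in cocycle_pred }.
HB.instance Definition _ := [isSub for coc_val].
HB.instance Definition _ := [Choice of cocycle by <:].
HB.instance Definition _ := [SubChoice_isSubZmodule of cocycle by <:].

Definition coboundary_pred : {pred cocycle} :=
  [pred z | `[< is_coboundary (val z) >]].
Fact coboundary_closed : zmod_closed coboundary_pred.
Proof.
split=> [|x y]; first by apply/asboolP; rewrite raddf0; apply: is_coboundary0.
move=> /asboolP xB /asboolP yB; apply/asboolP.
by rewrite raddfB; apply: is_coboundaryB.
Qed.
HB.instance Definition _ :=
  GRing.isZmodClosed.Build cocycle coboundary_pred coboundary_closed.

Definition cohomology : zmodType := Quotient.quot coboundary_pred.

Definition coh_class (z : cocycle) : cohomology := \pi z.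

Definition coh_repr (u : cohomology) : cocycle :=
  generic_quotient.repr (u : Quotient.quot coboundary_pred).

Lemma coh_class_eq (z t : cocycle) :
  is_coboundary (val z - val t) -> coh_class z = coh_class t.
Proof.
by move=> zt; apply/eqP; rewrite /coh_class -Quotient.idealrBE; apply/asboolP.
Qed.

Lemma coh_class_repr (u : cohomology) : coh_class (coh_repr u) = u.
Proof. exact: reprK. Qed.

Lemma coh_repr_class (z : cocycle) :
  is_coboundary (val (coh_repr (coh_class z)) - val z).
Proof.
have /eqP := coh_class_repr (coh_class z).
by rewrite /coh_class -Quotient.idealrBE => /asboolP.
Qed.

Fact coh_classB : zmod_morphism coh_class.
Proof. by move=> z t; rewrite /coh_class raddfB. Qed.
HB.instance Definition _ :=
  GRing.isZmodMorphism.Build cocycle cohomology coh_class coh_classB.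
End Cohomology.

Section CohomologyMap.
Variables (X Y : cochain) (f : cochain_map X Y) (q : nat).

Fact cocycle_map_subproof (z : cocycle X q) : f q (val z) \in @cocycle_pred Y q.
Proof.
by have /eqP zc := coc_valP z; rewrite inE -cmapE zc raddf0.
Qed.
Definition cocycle_map (z : cocycle X q) : cocycle Y q :=
  Cocycle (cocycle_map_subproof z).

Definition coh_map (u : cohomology X q) : cohomology Y q :=
  coh_class (cocycle_map (coh_repr u)).

Lemma coh_map_class (z : cocycle X q) :
  coh_map (coh_class z) = coh_class (cocycle_map z).
Proof.
apply: coh_class_eq; rewrite /= -raddfB.
exact/is_coboundary_map/coh_repr_class.
Qed.

Fact coh_mapB : zmod_morphism coh_map.
Proof.
move=> u v; rewrite -[u]coh_class_repr -[v]coh_class_repr -raddfB.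
rewrite !coh_map_class -raddfB; congr coh_class.
by apply: val_inj => /=; rewrite !raddfB.
Qed.
HB.instance Definition _ :=
  GRing.isZmodMorphism.Build (cohomology X q) (cohomology Y q) coh_map coh_mapB.
End CohomologyMap.

Lemma coh_ind (X : cochain) q (P : cohomology X q -> Prop) :
  (forall z, P (coh_class z)) -> forall u, P u.
Proof. by move=> Pz u; rewrite -[u]coh_class_repr. Qed.

(* Contravariant functors from left R-modules to abelian groups. *)
Record functor (R : pzRingType) := Functor {
  fobj :> lmodType R -> zmodType;
  fmor : forall M N : lmodType R, {linear M -> N} -> {additive fobj N -> fobj M};
  fmor_id : forall (M : lmodType R) x, fmor (idfun : {linear M -> M}) x = x;
  fmor_comp : forall (M N P : lmodType R) (g : {linear N -> P})
      (f : {linear M -> N}) x,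
    fmor (g \o f : {linear M -> P}) x = fmor f (fmor g x) }.

Definition nat_iso (R : pzRingType) (F G : functor R) :=
  exists eta : forall M, {additive F M -> G M},
    (forall M, bijective (eta M)) /\
    (forall (M N : lmodType R) (f : {linear M -> N}) x,
       eta M (fmor F f x) = fmor G f (eta N x)).

(* Contravariant functors from left R-modules to cochain complexes. *)
Record cfunctor (R : pzRingType) := CFunctor {
  cfobj :> lmodType R -> cochain;
  cfmor : forall M N : lmodType R, {linear M -> N} ->
    cochain_map (cfobj N) (cfobj M);
  cfmor_id : forall (M : lmodType R) q x,
    cfmor (idfun : {linear M -> M}) q x = x;
  cfmor_comp : forall (M N P : lmodType R) (g : {linear N -> P})
      (f : {linear M -> N}) q x,
    cfmor (g \o f : {linear M -> P}) q x = cfmor f q (cfmor g q x) }.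

Section CohomologyFunctor.
Variables (R : pzRingType) (F : cfunctor R) (q : nat).

Fact coh_functor_id (M : lmodType R) (u : cohomology (F M) q) :
  coh_map (cfmor F (idfun : {linear M -> M})) u = u.
Proof.
elim/coh_ind: u => z; rewrite coh_map_class; congr coh_class.
by apply: val_inj; rewrite /= cfmor_id.
Qed.
Fact coh_functor_comp (M N P : lmodType R) (g : {linear N -> P})
    (f : {linear M -> N}) (u : cohomology (F P) q) :
  coh_map (cfmor F (g \o f : {linear M -> P})) u =
    coh_map (cfmor F f) (coh_map (cfmor F g) u).
Proof.
elim/coh_ind: u => z; rewrite !coh_map_class; congr coh_class.
by apply: val_inj; rewrite /= cfmor_comp.
Qed.

Definition coh_functor : functor R :=
  @Functor R (fun M => cohomology (F M) q)
    (fun M N f => @coh_map (F N) (F M) (cfmor F f) q) coh_functor_id coh_functor_comp.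
End CohomologyFunctor.

Record mcochain (R : pzRingType) := MCochain {
  mobj :> nat -> lmodType R;
  mdiff : forall q, {linear mobj q -> mobj q.+1};
  mdiffK : forall q x, mdiff q.+1 (mdiff q x) = 0 }.

Section HomComplex.
Variables (R : pzRingType) (C : mcochain R).

Fact hom_cochain_dd (M : lmodType R) q (g : hom M (C q)) :
  postcomp (mdiff C q.+1) (postcomp (mdiff C q) g) = 0.
Proof. by apply: homP => x /=; rewrite mdiffK. Qed.
Definition hom_cochain (M : lmodType R) : cochain :=
  @Cochain (fun q => hom M (C q)) (fun q => @postcomp R M _ _ (mdiff C q))
    (@hom_cochain_dd M).

Definition hom_cochain_map (M N : lmodType R) (f : {linear M -> N}) :
    cochain_map (hom_cochain N) (hom_cochain M).
Proof.
exists (fun q => @precomp R M N (C q) f : {additive _ -> _}).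
by move=> q g; apply: homP.
Defined.

Definition hom_complex : cfunctor R.
Proof.
by exists hom_cochain hom_cochain_map => *; apply: homP.
Defined.
End HomComplex.

(* The free left R-module on the set K: finitely supported functions K -> R. *)
Section Free.
Variables (R : pzRingType) (K : choiceType).

Definition free : Type := {malg R[K]}.
HB.instance Definition _ := GRing.Zmodule.on free.

Implicit Types (c : R) (u : free).

Definition free_scale c u : free := \sum_(k <- msupp u) << c * u@_k *g k >>.

Lemma free_scaleE c u k : (free_scale c u)@_k = c * u@_k.
Proof.
rewrite {2}[u]monalgE !raddf_sum mulr_sumr.
by apply/eq_bigr=> /= i _; rewrite !mcoeffU mulrnAr.
Qed.
Fact free_scaleA c d u : free_scale c (free_scale d u) = free_scale (c * d) u.
Proof. by apply/malgP=> x; rewrite !free_scaleE mulrA. Qed.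
Fact free_scale1 : left_id 1 free_scale.
Proof. by move=> u; apply/malgP=> k; rewrite !free_scaleE mul1r. Qed.
Fact free_scaleDr : right_distributive free_scale +%R.
Proof. by move=> c u v; apply/malgP=> k; rewrite !(mcoeffD, free_scaleE) mulrDr. Qed.
Fact free_scaleDl u : {morph free_scale^~ u : c d / c + d}.
Proof. by move=> c d; apply/malgP=> x; rewrite !(mcoeffD, free_scaleE) mulrDl. Qed.
HB.instance Definition _ := GRing.Zmodule_isLmodule.Build R free
  free_scaleA free_scale1 free_scaleDr free_scaleDl.

Definition free_gen (k : K) : free := << k >>.

Section Lift.
Variables (M : lmodType R) (phi : K -> M).

Definition free_lift u : M := \sum_(k <- msupp u) u@_k *: phi k.

Lemma free_liftEw u (D : {fset K}) : (msupp u `<=` D)%fset ->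
  free_lift u = \sum_(k <- D) u@_k *: phi k.
Proof.
move=> sD; apply: big_fset_incl => // k _ ku.
by rewrite mcoeff_outdom // scale0r.
Qed.
Fact free_lift_linear : linear free_lift.
Proof.
move=> c u v; pose D := (msupp u `|` msupp v `|` msupp (c *: u + v)%R)%fset.
rewrite !(@free_liftEw _ D).
- rewrite scaler_sumr -big_split /=; apply: eq_bigr => k _.
  by rewrite mcoeffD free_scaleE scalerDl scalerA.
- by apply/fsubsetP=> k ku; rewrite !in_fsetU ku ?orbT.
- by apply/fsubsetP=> k ku; rewrite !in_fsetU ku ?orbT.
- by apply/fsubsetP=> k ku; rewrite !in_fsetU ku ?orbT.
Qed.
HB.instance Definition _ :=
  GRing.isLinear.Build R free M _ free_lift free_lift_linear.

Lemma free_lift_gen k : free_lift (free_gen k) = phi k.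
Proof.
rewrite (@free_liftEw _ [fset k]%fset) ?msuppU_le // big_seq_fset1.
by rewrite mcoeffUU scale1r.
Qed.
End Lift.

Lemma free_lift_id u : free_lift free_gen u = u.
Proof.
rewrite [RHS]monalgE; apply: eq_bigr => k _; apply/malgP => l.
by rewrite free_scaleE !mcoeffU mulrnAr mulr1.
Qed.

Lemma free_lift_comp (M N : lmodType R) (h : {linear M -> N}) (phi : K -> M) u :
  h (free_lift phi u) = free_lift (h \o phi) u.
Proof. by rewrite linear_sum; apply: eq_bigr => k _; rewrite linearZ. Qed.
End Free.

(* The functorial free resolution of M: syz 0 M = M and syz q.+1 M is the kernel
   of the canonical surjection from the free module on syz q M onto syz q M. *)
Section Resolution.
Variable R : pzRingType.

Section Kernel.
Variables (M N : lmodType R) (f : {linear M -> N}).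
Definition ker_pred : {pred M} := [pred x | f x == 0].
Fact ker_pred_closed : submod_closed ker_pred.
Proof.
split=> [|a x y]; first by rewrite inE raddf0.
by rewrite !inE => /eqP fx /eqP fy; rewrite linearP fx fy scaler0 addr0.
Qed.
HB.instance Definition _ :=
  GRing.isSubmodClosed.Build R M ker_pred ker_pred_closed.
Definition kersm : submodClosed M := ker_pred.
End Kernel.

Section Corestriction.
Variables (M N : lmodType R) (f : {linear M -> N}) (J : submodClosed N).
Hypothesis fJ : forall x, f x \in J.
Definition corestr (x : M) : submod J := Submod (fJ x).
Fact corestr_linear : linear corestr.
Proof. by move=> a x y; apply: val_inj; rewrite /= !linearP. Qed.
HB.instance Definition _ :=
  GRing.isLinear.Build R M (submod J) _ corestr corestr_linear.
End Corestriction.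

Definition free_eval (M : lmodType R) : {linear free R M -> M} :=
  @free_lift R M M id.

Definition free_map (M N : lmodType R) (f : {linear M -> N}) :
    {linear free R M -> free R N} :=
  @free_lift R M (free R N) (fun x => free_gen R (f x)).

Lemma free_eval_map (M N : lmodType R) (f : {linear M -> N}) u :
  free_eval N (free_map f u) = f (free_eval M u).
Proof.
rewrite /free_eval /free_map !free_lift_comp; congr free_lift.
by apply: funext => x /=; rewrite free_lift_gen.
Qed.
Lemma free_map_id (M : lmodType R) u : free_map (idfun : {linear M -> M}) u = u.
Proof. exact: free_lift_id. Qed.
Lemma free_map_comp (M N P : lmodType R) (g : {linear N -> P})
    (f : {linear M -> N}) u :
  free_map (g \o f : {linear M -> P}) u = free_map g (free_map f u).
Proof.
rewrite /free_map free_lift_comp; congr free_lift.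
by apply: funext => x /=; rewrite free_lift_gen.
Qed.

Lemma free_map_ext (M N : lmodType R) (f g : {linear M -> N}) :
  f =1 g -> free_map f =1 free_map g.
Proof.
by move=> fg u; rewrite /free_map; congr free_lift; apply: funext => x; rewrite fg.
Qed.

Definition syz1 (M : lmodType R) : lmodType R := submod (kersm (free_eval M)).

Fact syz1_map_subproof (M N : lmodType R) (f : {linear M -> N}) (x : syz1 M) :
  free_map f (val x) \in kersm (free_eval N).
Proof.
have /eqP x0 := submod_valP x.
by rewrite inE free_eval_map x0 raddf0.
Qed.
Definition syz1_map (M N : lmodType R) (f : {linear M -> N}) :
    {linear syz1 M -> syz1 N} :=
  @corestr (syz1 M) (free R N)
    (free_map f \o (val : {linear syz1 M -> free R M}))
    (kersm (free_eval N)) (syz1_map_subproof f).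

Lemma syz1_mapE (M N : lmodType R) (f : {linear M -> N}) (x : syz1 M) :
  val (syz1_map f x) = free_map f (val x).
Proof. by []. Qed.

Fixpoint syz (q : nat) (M : lmodType R) : lmodType R :=
  if q is p.+1 then syz1 (syz p M) else M.

Fixpoint syz_map (q : nat) (M N : lmodType R) (f : {linear M -> N}) :
    {linear syz q M -> syz q N} :=
  match q return {linear syz q M -> syz q N} with
  | 0 => f
  | p.+1 => syz1_map (syz_map p f)
  end.

Lemma syz_map_id q (M : lmodType R) x :
  syz_map q (idfun : {linear M -> M}) x = x.
Proof.
elim: q x => [|q IHq] x //; apply: val_inj; rewrite [LHS]syz1_mapE.
by rewrite -[RHS]free_map_id; apply: free_map_ext.
Qed.
Lemma syz_map_comp q (M N P : lmodType R) (g : {linear N -> P})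
    (f : {linear M -> N}) x :
  syz_map q (g \o f : {linear M -> P}) x = syz_map q g (syz_map q f x).
Proof.
elim: q x => [|q IHq] x //; apply: val_inj; rewrite !syz1_mapE.
by rewrite -free_map_comp; apply: free_map_ext.
Qed.

Definition res (q : nat) (M : lmodType R) : lmodType R := free R (syz q M).
Definition res_map (q : nat) (M N : lmodType R) (f : {linear M -> N}) :
  {linear res q M -> res q N} := free_map (syz_map q f).

Lemma res_map_id q (M : lmodType R) u :
  res_map q (idfun : {linear M -> M}) u = u.
Proof.
by rewrite -[RHS]free_map_id; apply: free_map_ext => x; apply: syz_map_id.
Qed.
Lemma res_map_comp q (M N P : lmodType R) (g : {linear N -> P})
    (f : {linear M -> N}) u :
  res_map q (g \o f : {linear M -> P}) u = res_map q g (res_map q f u).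
Proof.
by rewrite -free_map_comp; apply: free_map_ext => x; apply: syz_map_comp.
Qed.

Definition res_diff (q : nat) (M : lmodType R) :
    {linear res q.+1 M -> res q M} :=
  (val : {linear syz q.+1 M -> res q M}) \o free_eval (syz q.+1 M).

Lemma res_diffK q (M : lmodType R) x : res_diff q M (res_diff q.+1 M x) = 0.
Proof.
have /eqP e := submod_valP (free_eval (syz q.+2 M) x).
transitivity (val (free_eval (syz q.+1 M) (val (free_eval (syz q.+2 M) x)))).
  by [].
by rewrite e raddf0.
Qed.
Lemma res_map_diff q (M N : lmodType R) (f : {linear M -> N}) x :
  res_diff q N (res_map q.+1 f x) = res_map q f (res_diff q M x).
Proof. by rewrite /res_diff /res_map /= free_eval_map. Qed.
End Resolution.

(* Ext^q(-, E) is the q-th cohomology of Hom(res, E), where res is the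
   functorial free resolution above. *)
Section Ext.
Variables (R : pzRingType) (E : lmodType R).

Fact ext_cochain_dd (M : lmodType R) q (g : hom (res q M) E) :
  precomp (res_diff q.+1 M) (precomp (res_diff q M) g) = 0.
Proof. by apply: homP => x; rewrite precompE precompE res_diffK raddf0. Qed.
Definition ext_cochain (M : lmodType R) : cochain :=
  @Cochain (fun q => hom (res q M) E)
    (fun q => @precomp R _ _ E (res_diff q M)) (@ext_cochain_dd M).

Definition ext_cochain_map (M N : lmodType R) (f : {linear M -> N}) :
    cochain_map (ext_cochain N) (ext_cochain M).
Proof.
exists (fun q => @precomp R _ _ E (res_map q f) : {additive _ -> _}).
move=> q g; apply: homP => x; rewrite [LHS]precompE [RHS]precompE.
by rewrite [LHS]precompE [RHS]precompE res_map_diff.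
Defined.

Definition ext_complex : cfunctor R.
Proof.
exists ext_cochain ext_cochain_map.
- by move=> M q g; apply: homP => x; rewrite [LHS]precompE res_map_id.
- move=> M N P g f q h; apply: homP => x.
  by rewrite [LHS]precompE [RHS]precompE [in RHS]precompE res_map_comp.
Defined.

Definition Ext (q : nat) : functor R := coh_functor ext_complex q.
End Ext.

(* multi_index is not restricted to increasing or injective families; the
   alternating condition is stated on transpositions.  bigaddsm is the sum
   I_(alpha 0) + ... + I_(alpha q). *)
Section Cech.
Variables (R : pzRingType) (A : lmodType R) (n : nat).
Variable I : 'I_n.+1 -> submodClosed A.

Definition multi_index (q : nat) := {ffun 'I_q.+1 -> 'I_n.+1}.

Definition swap_index q (a b : 'I_q.+1) (alpha : multi_index q) :
  multi_index q := [ffun j => alpha (tperm a b j)].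

Definition omit_index q (p : 'I_q.+2) (alpha : multi_index q.+1) :
  multi_index q := [ffun j => alpha (lift p j)].

Section Degree.
Variable q : nat.

Definition alternating (i : {ffun multi_index q -> A}) : bool :=
  [forall alpha : multi_index q, forall a : 'I_q.+1, forall b : 'I_q.+1,
     (a != b) ==>
       (i (swap_index a b alpha) == - i alpha) &&
       ((alpha a == alpha b) ==> (i alpha == 0))].

Lemma alternatingP (i : {ffun multi_index q -> A}) :
  reflect (forall alpha (a b : 'I_q.+1), a != b ->
             i (swap_index a b alpha) = - i alpha /\
             (alpha a = alpha b -> i alpha = 0))
          (alternating i).
Proof.
apply: (iffP idP) => [/forallP H alpha a b ab|H].
  have /implyP/(_ ab)/andP[/eqP-> /implyP h] := forallP (forallP (H alpha) a) b.
  by split=> // /eqP/h/eqP.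
apply/forallP=> alpha; apply/forallP=> a; apply/forallP=> b; apply/implyP=> ab.
have [-> h] := H alpha a b ab; rewrite eqxx; apply/implyP=> /eqP/h->.
exact: eqxx.
Qed.

Definition cech_pred : {pred {ffun multi_index q -> A}} :=
  [pred i : {ffun multi_index q -> A} |
     [forall alpha : multi_index q,
        i alpha \in bigaddsm (fun j : 'I_q.+1 => I (alpha j))]
     && alternating i].

Fact cech_pred_closed : submod_closed cech_pred.
Proof.
split=> [|c i j].
  apply/andP; split; first by apply/forallP=> alpha; rewrite ffunE rpred0.
  by apply/alternatingP=> alpha a b _; rewrite !ffunE oppr0.
move=> /andP[/forallP iI /alternatingP ialt].
move=> /andP[/forallP jI /alternatingP jalt]; apply/andP; split.
  by apply/forallP=> alpha; rewrite !ffunE rpredD ?rpredZ.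
apply/alternatingP=> alpha a b ab; rewrite !ffunE.
have [-> i0] := ialt alpha a b ab; have [-> j0] := jalt alpha a b ab.
split=> [|e]; first by rewrite scalerN opprD.
by rewrite i0 ?j0 // scaler0 addr0.
Qed.
HB.instance Definition _ :=
  GRing.isSubmodClosed.Build R {ffun multi_index q -> A} cech_pred
    cech_pred_closed.
Definition cechsm : submodClosed {ffun multi_index q -> A} := cech_pred.
Definition cech_mod : lmodType R := submod cechsm.

Lemma alternating_perm (i : {ffun multi_index q -> A}) (s : 'S_q.+1)
    (alpha : multi_index q) :
  alternating i ->
  i [ffun j => alpha (s j)] = (-1) ^+ (s : bool) *: i alpha.
Proof.
move=> /alternatingP ialt; have [ts -> dts] := prod_tpermP s.
elim: ts dts => [_|[a b] ts IHts /= /andP[ab dts]].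
  rewrite big_nil odd_perm1 expr0 scale1r; congr (i _).
  by apply/ffunP=> j; rewrite ffunE perm1.
rewrite big_cons odd_mul_tperm ab signrN scaleNr -(IHts dts).
have [<- _] := ialt [ffun j => alpha ((\prod_(t <- ts) tperm t.1 t.2)%g j)] a b ab.
by congr (i _); apply/ffunP=> j; rewrite !ffunE permM.
Qed.

Definition cech_d_fun (i : {ffun multi_index q -> A}) :
    {ffun multi_index q.+1 -> A} :=
  [ffun alpha => \sum_(p < q.+2) (-1) ^+ p *: i (omit_index p alpha)].
End Degree.

Lemma perm_lift m (s : 'S_m.+1) p : exists t : 'S_m, s = lift_perm p (s p) t.
Proof.
pose f j := odflt j (unlift (s p) (s (lift p j))).
have fE j : lift (s p) (f j) = s (lift p j).
  have : s p != s (lift p j) by rewrite (inj_eq perm_inj) neq_lift.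
  by rewrite /f => /unlift_some[r -> ->].
have finj : injective f.
  by move=> j k /(congr1 (lift (s p))); rewrite !fE => /perm_inj/lift_inj.
exists (perm finj); apply/permP=> j; case: (unliftP p j) => [k|] ->.
  by rewrite lift_perm_lift permE fE.
by rewrite lift_perm_id.
Qed.

Lemma omit_perm q (i : {ffun multi_index q -> A}) (s : 'S_q.+2) (p : 'I_q.+2)
    (alpha : multi_index q.+1) :
  alternating i ->
  (-1) ^+ p *: i (omit_index p [ffun j => alpha (s j)]) =
  (-1) ^+ (s : bool) *: ((-1) ^+ (s p) *: i (omit_index (s p) alpha)).
Proof.
move=> ialt; have [t st] := perm_lift s p.
have -> : omit_index p [ffun j => alpha (s j)] =
    [ffun j => omit_index (s p) alpha (t j)].
  by apply/ffunP=> j; rewrite !ffunE {1}st lift_perm_lift.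
rewrite alternating_perm // !scalerA; congr (_ *: _).
have os : s = odd p (+) odd (s p) (+) t :> bool by rewrite {1}st odd_lift_perm.
rewrite -[(-1) ^+ p]signr_odd -[(-1) ^+ (s p)]signr_odd -!signr_addb os.
by congr ((-1) ^+ _); case: (odd p); case: (odd (s p)); case: (odd_perm t).
Qed.

Fact cech_d_closed q (i : {ffun multi_index q -> A}) :
  i \in cechsm q -> cech_d_fun i \in cechsm q.+1.
Proof.
move=> /andP[/forallP iI ialt]; apply/andP; split.
  apply/forallP=> alpha; rewrite ffunE; apply: rpred_sum => p _.
  rewrite rpredZ //; have /asboolP[y yI ->] := iI (omit_index p alpha).
  apply: rpred_sum => j _; apply/asboolP.
  exists (fun k => if k == lift p j then y j else 0) => [k|].
    by case: eqP => [->|_]; rewrite ?rpred0 //; have := yI j; rewrite ffunE.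
  by rewrite -big_mkcond big_pred1_eq.
apply/alternatingP=> alpha a b ab.
have dE (s : 'S_q.+2) : cech_d_fun i [ffun j => alpha (s j)] =
    (-1) ^+ (s : bool) *: cech_d_fun i alpha.
  rewrite !ffunE scaler_sumr [RHS](reindex_inj (@perm_inj _ s)).
  by apply: eq_bigr => p _; apply: omit_perm.
split; first by rewrite dE odd_tperm ab expr1 scaleN1r.
move=> eab; rewrite ffunE (bigD1 a) //= (bigD1 b) 1?eq_sym //=.
rewrite big1 ?addr0 => [|p /andP[pa pb]]; last first.
  have [a' ea _] := unlift_some pa; have [b' eb _] := unlift_some pb.
  have [] := elimT (alternatingP i) ialt (omit_index p alpha) a' b'.
    by rewrite -(inj_eq (@lift_inj _ p)) -ea -eb.
  by rewrite !ffunE -ea -eb => _ -> //; rewrite scaler0.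
have -> : alpha = [ffun j => alpha (tperm a b j)].
  by apply/ffunP=> j; rewrite ffunE; case: tpermP => [->|->|].
rewrite {1}omit_perm // tpermL odd_tperm ab expr1 scaleN1r.
have <- : alpha = [ffun j => alpha (tperm a b j)].
  by apply/ffunP=> j; rewrite ffunE; case: tpermP => [->|->|].
by rewrite addNr.
Qed.

Definition cech_d q (i : cech_mod q) : cech_mod q.+1 :=
  Submod (cech_d_closed (submod_valP i)).

Fact cech_d_linear q : linear (@cech_d q).
Proof.
move=> c i j; apply: val_inj; apply/ffunP=> alpha /=; rewrite !ffunE.
rewrite scaler_sumr -big_split /=; apply: eq_bigr => p _.
by rewrite !ffunE scalerDr !scalerA; congr (_ *: _ + _); apply/esym/commr_sign.
Qed.
HB.instance Definition _ q :=
  GRing.isLinear.Build R (cech_mod q) (cech_mod q.+1) _ (@cech_d q)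
    (@cech_d_linear q).

Lemma bump_swap (r p j : nat) :
  (r <= p)%N -> bump r (bump p j) = bump p.+1 (bump r j).
Proof. by rewrite /bump; case: (leqP p j); case: (leqP r j); lia. Qed.

Fact cech_dd q (i : cech_mod q) : cech_d (cech_d i) = 0.
Proof.
apply: val_inj; apply/ffunP=> alpha /=; rewrite !ffunE.
pose F (x : 'I_q.+3 * 'I_q.+2) :=
  (-1) ^+ (x.1 + x.2) *: val i (omit_index x.2 (omit_index x.1 alpha)).
transitivity (\sum_x F x).
  rewrite -(pair_bigA _ (fun p r => F (p, r))) /=; apply: eq_bigr => p _.
  rewrite ffunE scaler_sumr; apply: eq_bigr => r _.
  by rewrite scalerA -exprD.
rewrite (bigID (fun x : 'I_q.+3 * 'I_q.+2 => x.1 <= x.2)%N) /=.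
pose h (x : 'I_q.+3 * 'I_q.+2) : 'I_q.+3 * 'I_q.+2 := (inord x.2, inord x.1.-1).
pose h' (x : 'I_q.+3 * 'I_q.+2) : 'I_q.+3 * 'I_q.+2 := (inord x.2.+1, inord x.1).
rewrite (reindex_onto h h') => [|[p r] /= pr]; last first.
  have pq : (p < q.+2)%N by apply: leq_ltn_trans pr (ltn_ord r).
  congr (_, _); apply: val_inj.
    by rewrite /= !inordK //= ltnS ltnW.
  by rewrite /= !inordK //= ltnS; apply: ltn_ord.
have hP (x : 'I_q.+3 * 'I_q.+2) :
    ((h x).1 <= (h x).2)%N && (h' (h x) == x) = ~~ (x.1 <= x.2)%N.
  case: x => p r /=; have rq : (r < q.+3)%N by rewrite ltnS ltnW.
  have pq : (p.-1 < q.+2)%N by case: p => -[|p].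
  rewrite /h' /h /= !inordK // -ltnNge xpair_eqE -!val_eqE /= !inordK //.
  rewrite eqxx andbT; move: (nat_of_ord p) (nat_of_ord r) => a b.
  by case: a => [|a]; rewrite /= ?andbF // eqxx andbT.
rewrite (eq_bigl _ _ hP) -big_split big1 //= => -[p r] /=; rewrite -ltnNge => rp.
rewrite /F /=.
have rq : (r < q.+3)%N by rewrite ltnS ltnW.
have pq : (p.-1 < q.+2)%N by case: p {rp} => -[|p].
rewrite !inordK //.
have -> : omit_index (inord p.-1) (omit_index (inord r) alpha) =
    omit_index r (omit_index p alpha).
  apply/ffunP=> j; rewrite !ffunE; congr (alpha _); apply: val_inj => /=.
  rewrite !inordK //; have p0 : (0 < p)%N by apply: leq_ltn_trans rp.
  by rewrite -{2}(prednK p0) -bump_swap // -ltnS prednK.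
have p0 : (0 < p)%N by apply: leq_ltn_trans rp.
have -> : (p + r)%N = (r + p.-1).+1 by rewrite -addnS prednK // addnC.
by rewrite -scalerDl exprS mulN1r subrr scale0r.
Qed.

Definition cech : mcochain R :=
  @MCochain R cech_mod (fun q => @cech_d q) cech_dd.
End Cech.

(* Main.v *)
Require Import Defs.
From HB Require Import structures.
From mathcomp Require Import all_boot all_order all_fingroup all_algebra.
From mathcomp Require Import boolp zify.

(** An injective submodule J of A is a direct summand, so there is a linear
retraction e of A onto J.  In a distributive module such an e maps every
submodule K into itself: distributivity, applied to ker e, K and J, gives
K = (K \cap ker e) + (K \cap J), and e kills the first summand and fixes the
second (retraction_stable).  All consequences below come from the retractions
e_0, ..., e_n onto I_0, ..., I_n and from this stability.

The composite of all the e_j maps each I_j, and hence A, into the intersection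
of the I_j and fixes that intersection (bigcap_retract).  So the intersection
is a retract of the injective module I_0, thus injective, and its Ext groups
vanish in positive degrees.

The same retractions split the complex C.  Let E_v = e_(v-1) ... e_0, and
put p_v = E_v - E_(v+1) for v < n and p_n = E_n.  The p_v sum to the identity,
and they preserve every submodule.  If v < n then p_v kills I_v, because e_v
fixes I_v; and p_n has its values in every I_j with j < n.  The formula
(h i)_alpha = \sum_v p_v (i_(v, alpha)), which is the usual cone homotopy of a
simplex with the apex averaged over the partition p, is therefore a linear map
from C^(q+1) to C^q, and d h + h d = 1 on C^(q+1) (cech_homotopy).
Composition with h shows that Hom_R(M, C) has no cohomology in positive
degrees.

In degree 0 both functors are Hom_R(-, \bigcap_j I_j): on the side of Ext by
exactness of res 1 M -> res 0 M -> M -> 0, and on the side of C because a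
0-cocycle is a constant family (ext_cech_iso0). *)

Set Implicit Arguments.
Unset Strict Implicit.
Unset Printing Implicit Defensive.

Import GRing.Theory.
Local Open Scope ring_scope.

(** * Linear maps defined by a choice of preimages *)

Lemma factor_linear (R : pzRingType) (M N P : lmodType R)
    (f : {linear M -> N}) (g : {linear M -> P}) :
  (forall y, exists x, f x = y) -> (forall x, f x = 0 -> g x = 0) ->
  exists h : {linear N -> P}, forall x, h (f x) = g x.
Proof.
move=> /choice[s fs] gker; pose h y := g (s y).
have hE x : h (f x) = g x.
  have: g (s (f x) - x) = 0 by apply: gker; rewrite raddfB /= fs subrr.
  by rewrite raddfB /= => /eqP; rewrite subr_eq0 => /eqP.
have hlin : linear h.
  by move=> a x y; rewrite -(fs x) -(fs y) -linearP !hE linearP.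
pose m := GRing.isLinear.Build R N P _ h hlin.
by pose hL : {linear N -> P} := HB.pack h m; exists hL.
Qed.

Lemma lift_linear (R : pzRingType) (M N P : lmodType R)
    (f : {linear N -> P}) (g : {linear M -> P}) :
  injective f -> (forall x, exists y, f y = g x) ->
  exists h : {linear M -> N}, forall x, f (h x) = g x.
Proof.
move=> finj /choice[h fh].
have hlin : linear h.
  by move=> a x y; apply: finj; rewrite fh !linearP !fh.
pose m := GRing.isLinear.Build R M N _ h hlin.
by pose hL : {linear M -> N} := HB.pack h m; exists hL.
Qed.

(** * Natural isomorphisms in cohomology from relations between cocycles *)

(** An additive relation that is total and respects coboundaries induces a map
in cohomology, although the cocycle related to a given one is determined only
up to a coboundary: two choices differ by a cocycle related to 0. *)

Section CohRelation.
Variables (X Y : cochain) (q : nat) (rel : cocycle X q -> cocycle Y q -> Prop).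
Hypothesis relB : forall z t z' t',
  rel z t -> rel z' t' -> rel (z - z') (t - t').
Hypothesis rel_total : forall z, exists t, rel z t.
Hypothesis rel_bnd : forall z t,
  rel z t -> is_coboundary (val z) -> is_coboundary (val t).

Lemma coh_rel_map : exists eta : {additive cohomology X q -> cohomology Y q},
  forall z t, rel z t -> eta (coh_class z) = coh_class t.
Proof.
have [T relT] := choice rel_total.
pose eta (u : cohomology X q) : cohomology Y q := coh_class (T (coh_repr u)).
have etaE z t : rel z t -> eta (coh_class z) = coh_class t.
  move=> zt; apply: coh_class_eq; rewrite -raddfB.
  apply: rel_bnd (relB (relT _) zt) _; rewrite raddfB.
  exact: coh_repr_class.
have etaB : zmod_morphism eta.
  move=> u v; elim/coh_ind: u => z; elim/coh_ind: v => z'.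
  have [[t zt] [t' zt']] := (rel_total z, rel_total z').
  rewrite -raddfB (etaE _ _ (relB zt zt')) (etaE _ _ zt) (etaE _ _ zt').
  exact: raddfB.
pose m := GRing.isZmodMorphism.Build _ _ eta etaB.
pose etaA : {additive cohomology X q -> cohomology Y q} := HB.pack eta m.
by exists etaA.
Qed.
End CohRelation.

(** The conditions on [rel] are symmetric, so the inverse of the induced map is
the map induced by the converse relation.  This avoids a choice of natural
maps between cocycles. *)
Lemma nat_iso_relation (R : pzRingType) (F G : cfunctor R) (q : nat)
    (rel : forall M, cocycle (F M) q -> cocycle (G M) q -> Prop) :
  (forall M z t z' t', rel M z t -> rel M z' t' -> rel M (z - z') (t - t')) ->
  (forall M z, exists t, rel M z t) -> (forall M t, exists z, rel M z t) ->
  (forall M z t, rel M z t -> is_coboundary (val z) <-> is_coboundary (val t)) ->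
  (forall (M N : lmodType R) (f : {linear M -> N}) z t, rel N z t ->
     rel M (cocycle_map (cfmor F f) z) (cocycle_map (cfmor G f) t)) ->
  nat_iso (coh_functor F q) (coh_functor G q).
Proof.
move=> relB totl totr bnd relnat.
have etaM M : exists eta : {additive cohomology (F M) q -> cohomology (G M) q},
    forall z t, rel M z t -> eta (coh_class z) = coh_class t.
  by apply: coh_rel_map (relB M) (totl M) _ => z t /bnd[].
have [eta etaE] : exists eta : forall M,
    {additive cohomology (F M) q -> cohomology (G M) q},
    forall M z t, rel M z t -> eta M (coh_class z) = coh_class t.
  by exists (fun M => projT1 (cid (etaM M))) => M; case: (cid (etaM M)).
exists eta; split=> [M|M N f u].
  have [|||theta thetaE] := @coh_rel_map (G M) (F M) q (fun t z => rel M z t).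
  - by move=> t z t' z'; apply: relB.
  - exact: totr.
  - by move=> t z /bnd[].
  exists theta => u; elim/coh_ind: u => z.
    by have [t zt] := totl M z; rewrite (etaE _ _ _ zt) (thetaE _ _ zt).
  by have [t zt] := totr M z; rewrite (thetaE _ _ zt) (etaE _ _ _ zt).
elim/coh_ind: u => z; have [t zt] := totl N z.
by rewrite /= (etaE _ _ _ zt) !coh_map_class (etaE _ _ _ (relnat _ _ f _ _ zt)).
Qed.

(** * Extensions into an injective module *)

Lemma free_eval_surj (R : pzRingType) (M : lmodType R) (x : M) :
  exists u, free_eval M u = x.
Proof. by exists (free_gen R x); apply: free_lift_gen. Qed.

(** A cocycle vanishes on the image of the next differential, which by
construction of the resolution is the kernel of [free_eval]. *)
Lemma ext_cocycle_ker (R : pzRingType) (E M : lmodType R) q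
    (g : Defs.hom (res q M) E) u :
  precomp (res_diff q M) g = 0 -> free_eval (syz q M) u = 0 -> g u = 0.
Proof.
move=> dg u0; have uK : u \in kersm (free_eval (syz q M)) by apply/eqP.
have [w wE] := free_eval_surj (Submod uK : syz q.+1 M).
transitivity (precomp (res_diff q M) g w); last by rewrite dg.
by rewrite precompE /res_diff /= wE.
Qed.

(** A cocycle of degree q.+1 factors through the syzygy [syz q.+1 M], which is a
submodule of [res q M]; injectivity extends it there. *)
Lemma ext_injective (R : pzRingType) (E M : lmodType R) q
    (g : Defs.hom (res q.+1 M) E) :
  injective_module E -> precomp (res_diff q.+1 M) g = 0 ->
  exists y : Defs.hom (res q M) E, g = precomp (res_diff q M) y.
Proof.
move=> Einj dg.
have [h hE] := factor_linear (@free_eval_surj R (syz q.+1 M))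
  (fun u => @ext_cocycle_ker R E M q.+1 g u dg).
have [y yE] := Einj (syz q.+1 M) (res q M) val h val_inj.
by exists y; apply: homP => u; rewrite precompE /res_diff /= yE hE.
Qed.

(** * Retractions onto submodules of a distributive module *)

Section Retractions.
Variables (R : pzRingType) (A : lmodType R).

Definition retraction (J : submodClosed A) (e : {linear A -> A}) :=
  (forall x, e x \in J) /\ {in J, forall x, e x = x}.

Lemma injective_retraction (J : submodClosed A) :
  injective_module (submod J) -> exists e, retraction J e.
Proof.
move=> Jinj.
have [r rK] := Jinj (submod J) A val idfun val_inj.
exists (val \o r : {linear A -> A}); split=> x /=; first exact: submod_valP.
by move=> xJ; rewrite (rK (Submod xJ)).
Qed.

(** Distributivity cuts K along the decomposition of A into ker e and J: each
element of K is a sum of an element of K killed by e and of an element of K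
fixed by e. *)
Lemma retraction_stable (J K : submodClosed A) (e : {linear A -> A}) x :
  distributive_module A -> retraction J e -> x \in K -> e x \in K.
Proof.
move=> Adist [eJ eid] xK.
have: x \in capsm (addsm (kersm e) K) (addsm (kersm e) J).
  apply/andP; split; apply/asboolP.
    by exists 0, x; rewrite rpred0 add0r.
  exists (x - e x), (e x); rewrite eJ subrK; split=> //.
  by apply/eqP; rewrite raddfB /= [e (e x)]eid ?eJ ?subrr.
rewrite -Adist => /asboolP[y [z [/eqP ey /andP[zK zJ] ->]]].
by rewrite raddfD /= ey add0r eid.
Qed.
End Retractions.

(** * A contracting homotopy of the alternating complex *)

Section Contraction.
Variables (R : pzRingType) (A : lmodType R) (n : nat).
Variables (I : 'I_n.+1 -> submodClosed A) (e : 'I_n.+1 -> {linear A -> A}).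
Hypothesis Adist : distributive_module A.
Hypothesis eI : forall j, retraction (I j) (e j).

(** The composite of the retractions with index below k, that of index 0 applied
first.  It maps A into I_j for every j < k, because the factors applied after
e_j preserve I_j. *)
Fixpoint retract_below (k : nat) : {linear A -> A} :=
  if k is m.+1 then (e (inord m) \o retract_below m : {linear A -> A})
  else idfun.

Lemma retract_below_stable (K : submodClosed A) k x :
  x \in K -> retract_below k x \in K.
Proof.
by move=> xK; elim: k => //= k; apply: retraction_stable (eI (inord k)).
Qed.

Lemma retract_below_mem (j : 'I_n.+1) k x :
  (j < k)%N -> retract_below k x \in I j.
Proof.
elim: k => //= k IHk; rewrite ltnS leq_eqVlt => /orP[/eqP<-|/IHk].
  by rewrite inord_val; apply: (eI j).1.
exact: retraction_stable (eI (inord k)).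
Qed.

Lemma retract_below_id k x : (forall j, x \in I j) -> retract_below k x = x.
Proof.
by move=> xI; elim: k => //= k ->; apply: (eI (inord k)).2; apply: xI.
Qed.

(** The telescoping partition of the identity that weights the homotopy.  The
last weight is not cut by [e ord_max]: the weights then sum to the identity,
and not only to the projection along the intersection of the I_j. *)
Definition part (v : 'I_n.+1) : {linear A -> A} :=
  if v == ord_max then retract_below n
  else (retract_below v \- retract_below v.+1 : {linear A -> A}).

Lemma sum_part x : \sum_v part v x = x.
Proof.
rewrite big_ord_recr /= /part eqxx.
under eq_bigr => v _.
  have -> : (widen_ord (leqnSn n) v == ord_max) = false.
    by apply/negbTE; rewrite -val_eqE /= neq_ltn ltn_ord.
  over.
pose f k := - retract_below k x.
rewrite (eq_bigr (fun v : 'I_n => f v.+1 - f v)) => [|v _]; last first.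
  by rewrite /f opprK addrC.
rewrite -(big_mkord predT (fun k => f k.+1 - f k)) telescope_sumr //.
by rewrite /f opprK addrAC addNr add0r.
Qed.

(** What makes the homotopy well defined.  For v < n the weight of v kills I v and
preserves K; for v = n it maps everything into I j, which lies in K. *)
Lemma part_mem (v j : 'I_n.+1) (K : submodClosed A) x :
  v != j -> {subset I j <= K} -> x \in addsm (I v) K -> part v x \in K.
Proof.
move=> vj jK /asboolP[y [z [yI zK ->]]]; rewrite /part; case: eqP => [vn|_].
  apply/jK/retract_below_mem; rewrite ltn_neqAle -ltnS ltn_ord andbT.
  by apply: contraNneq vj => jn; apply/eqP/val_inj; rewrite vn.
rewrite raddfD rpredD //=.
  have yv : retract_below v y \in I v by apply: retract_below_stable.
  by rewrite inord_val [e v _](eI v).2 ?subrr ?rpred0.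
have zv : retract_below v z \in K by apply: retract_below_stable.
rewrite rpredD // -scaleN1r rpredZ //.
exact: retraction_stable (eI (inord v)) zv.
Qed.

(** The multi-index (v, alpha_0, ..., alpha_q). *)
Definition cons_index q (v : 'I_n.+1) (alpha : multi_index n q) :
    multi_index n q.+1 :=
  [ffun j => if unlift ord0 j is Some k then alpha k else v].

Lemma cons_index0 q v (alpha : multi_index n q) : cons_index v alpha ord0 = v.
Proof. by rewrite ffunE unlift_none. Qed.

Lemma cons_indexS q v (alpha : multi_index n q) k :
  cons_index v alpha (lift ord0 k) = alpha k.
Proof. by rewrite ffunE liftK. Qed.

Lemma omit_cons0 q v (alpha : multi_index n q) :
  omit_index ord0 (cons_index v alpha) = alpha.
Proof. by apply/ffunP=> j; rewrite ffunE cons_indexS. Qed.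

Lemma omit_consS q v (alpha : multi_index n q.+1) p :
  omit_index (lift ord0 p) (cons_index v alpha) =
  cons_index v (omit_index p alpha).
Proof.
apply/ffunP=> j; rewrite ffunE; case: (unliftP ord0 j) => [k|] ->.
  have -> : lift (lift ord0 p) (lift ord0 k) = lift ord0 (lift p k).
    by apply: val_inj; rewrite /= /bump /=; lia.
  by rewrite !cons_indexS ffunE.
have -> : lift (lift ord0 p) ord0 = ord0 by apply: val_inj.
by rewrite !cons_index0.
Qed.

Lemma swap_cons q v (alpha : multi_index n q) a b :
  swap_index (lift ord0 a) (lift ord0 b) (cons_index v alpha) =
  cons_index v (swap_index a b alpha).
Proof.
apply/ffunP=> j; rewrite ffunE; case: (unliftP ord0 j) => [k|] ->.
  rewrite cons_indexS [RHS]ffunE; case: (tpermP a b k) => [->|->|/eqP ka /eqP kb].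
  - by rewrite tpermL cons_indexS.
  - by rewrite tpermR cons_indexS.
  by rewrite tpermD ?cons_indexS // (inj_eq lift_inj) eq_sym.
by rewrite tpermD ?cons_index0 // eq_sym neq_lift.
Qed.

Lemma bigaddsm_cons q v (alpha : multi_index n q) :
  {subset bigaddsm (fun j => I (cons_index v alpha j))
    <= addsm (I v) (bigaddsm (fun j => I (alpha j)))}.
Proof.
move=> x /asboolP[y yI ->]; rewrite big_ord_recl; apply/asboolP.
exists (y ord0), (\sum_k y (lift ord0 k)); split=> //.
  by rewrite -[v in I v](cons_index0 v alpha).
apply/asboolP; exists (fun k => y (lift ord0 k)) => // k.
by rewrite -[alpha k](cons_indexS v).
Qed.

Section Degree.
Variable q : nat.

Definition contract_fun (i : {ffun multi_index n q.+1 -> A}) :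
    {ffun multi_index n q -> A} :=
  [ffun alpha => \sum_v part v (i (cons_index v alpha))].

Fact contract_fun_linear : linear contract_fun.
Proof.
move=> c i j; apply/ffunP=> alpha; rewrite !ffunE scaler_sumr -big_split /=.
by apply: eq_bigr => v _; rewrite !ffunE linearP.
Qed.
HB.instance Definition _ :=
  GRing.isLinear.Build R {ffun multi_index n q.+1 -> A}
    {ffun multi_index n q -> A} _ contract_fun contract_fun_linear.

(** If v = alpha_0 then the alternating family vanishes at (v, alpha); otherwise
[part_mem] applies with j = alpha_0. *)
Lemma contract_closed (i : cech_mod I q.+1) :
  contract_fun (val i) \in cechsm I q.
Proof.
have /andP[/forallP iI /alternatingP ialt] := submod_valP i.
apply/andP; split.
  apply/forallP=> alpha; rewrite ffunE; apply: rpred_sum => v _.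
  have [v0|v0] := eqVneq v (alpha ord0).
    have [_ ->] := ialt (cons_index v alpha) ord0 (lift ord0 ord0) (neq_lift _ _).
      by rewrite raddf0 rpred0.
    by rewrite cons_index0 cons_indexS.
  apply: part_mem v0 _ (bigaddsm_cons (iI _)) => x xI; apply/asboolP.
  exists (fun k => if k == ord0 then x else 0) => [k|].
    by case: eqP => [->|]; rewrite ?rpred0.
  by rewrite -big_mkcond big_pred1_eq.
apply/alternatingP=> alpha a b ab; rewrite !ffunE.
have ab' : lift ord0 a != lift ord0 b by rewrite (inj_eq lift_inj).
split=> [|eab].
  rewrite -sumrN; apply: eq_bigr => v _.
  by rewrite -swap_cons (ialt _ _ _ ab').1 raddfN.
rewrite big1 // => v _.
by rewrite (ialt (cons_index v alpha) _ _ ab').2 ?raddf0 // !cons_indexS.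
Qed.

Definition contract : {linear cech_mod I q.+1 -> cech_mod I q} :=
  corestr (f := contract_fun \o (val : {linear cech_mod I q.+1 -> _}))
    contract_closed.
End Degree.

(** In the v-th summand of h (d i), omission of v gives back i_alpha, and the
other omissions are the terms of d (h i) with the opposite sign. *)
Lemma cech_homotopy q (i : cech_mod I q.+1) :
  cech_d (contract q i) + contract q.+1 (cech_d i) = i.
Proof.
apply: val_inj; apply/ffunP=> alpha; rewrite /= !ffunE -[RHS]sum_part.
under [X in X + _]eq_bigr => p _ do rewrite ffunE scaler_sumr.
rewrite exchange_big -big_split; apply: eq_bigr => v _ /=.
rewrite ffunE (big_ord_recl q.+2) omit_cons0 expr0 scale1r.
rewrite raddfD /= raddf_sum addrCA.
rewrite -big_split big1 ?addr0 //= => p _.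
by rewrite omit_consS -linearZ /= exprS mulN1r scaleNr raddfN addrN.
Qed.

Lemma bigcap_retract : exists r : {linear A -> A},
  (forall x, r x \in bigcapsm I) /\ {in bigcapsm I, forall x, r x = x}.
Proof.
exists (retract_below n.+1); split=> x.
  by apply/forallP=> j; apply/retract_below_mem/ltn_ord.
by move/forallP; apply: retract_below_id.
Qed.
End Contraction.

(** * Injective submodules of a distributive module *)

Section Distributive.
Variables (R : pzRingType) (A : lmodType R) (n : nat).
Variables (I : 'I_n.+1 -> submodClosed A).
Hypothesis Adist : distributive_module A.
Hypothesis I_inj : forall j, injective_module (submod (I j)).

Lemma injective_retractions :
  exists e : 'I_n.+1 -> {linear A -> A}, forall j, retraction (I j) (e j).
Proof.
by have /choice[e eI] := fun j => injective_retraction (@I_inj j); exists e.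
Qed.

(** The intersection is a retract of the injective module [I ord0]. *)
Lemma bigcap_injective : injective_module (submod (bigcapsm I)).
Proof.
have [e eI] := injective_retractions.
move=> M N f g finj; have [r [rI rid]] := bigcap_retract Adist eI.
have gI x : val (g x) \in I ord0 by apply: (forallP (submod_valP (g x))).
have [h hE] := @I_inj ord0 _ _ f
  (corestr (f := (val : {linear submod (bigcapsm I) -> A}) \o g) gI) finj.
exists (corestr (f := r \o ((val : {linear submod (I ord0) -> A}) \o h))
  (fun x => rI _)) => x.
by apply: val_inj; rewrite /= hE /= rid //; apply: submod_valP.
Qed.

Lemma cech_hom_exact (M : lmodType R) q (g : Defs.hom M (cech_mod I q.+1)) :
  (forall x, cech_d (g x) = 0) ->
  exists y : Defs.hom M (cech_mod I q), g = postcomp (@cech_d R A n I q) y.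
Proof.
have [e eI] := injective_retractions => dg.
exists (postcomp (contract Adist eI q) g); apply: homP => x.
by rewrite -[LHS](cech_homotopy Adist eI) dg raddf0 addr0.
Qed.
End Distributive.

(** * The augmentation and degree zero *)

Section Augmentation.
Variables (R : pzRingType) (A : lmodType R) (n : nat).
Variables (I : 'I_n.+1 -> submodClosed A).

Definition const_cochain (x : A) : {ffun multi_index n 0 -> A} := [ffun=> x].

Fact const_cochain_linear : linear const_cochain.
Proof. by move=> c x y; apply/ffunP=> alpha; rewrite !ffunE. Qed.
HB.instance Definition _ :=
  GRing.isLinear.Build R A {ffun multi_index n 0 -> A} _ const_cochain
    const_cochain_linear.

Lemma const_cochain_closed (x : submod (bigcapsm I)) :
  const_cochain (val x) \in cechsm I 0.
Proof.
have /forallP xI := submod_valP x.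
apply/andP; split; last by apply/alternatingP=> alpha a b; rewrite !ord1 eqxx.
apply/forallP=> alpha; rewrite ffunE; apply/asboolP.
by exists (fun=> val x); rewrite ?big_ord1.
Qed.

Definition cech_aug : {linear submod (bigcapsm I) -> cech_mod I 0} :=
  corestr (f := const_cochain \o (val : {linear submod (bigcapsm I) -> A}))
    const_cochain_closed.

Lemma cech_augE x alpha : val (cech_aug x) alpha = val x.
Proof. by rewrite ffunE. Qed.

Lemma cech_aug_inj : injective cech_aug.
Proof.
move=> x y xy; apply: val_inj.
by rewrite -(cech_augE x [ffun=> ord0]) xy cech_augE.
Qed.

Lemma cech_d_aug x : cech_d (cech_aug x) = 0.
Proof.
apply: val_inj; apply/ffunP=> alpha.
rewrite /= !ffunE !big_ord_recl big_ord0 !ffunE expr0 scale1r scaleN1r addr0.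
exact: subrr.
Qed.

(** The component of d c at (j, k) is c_k - c_j, so c is constant, and its value
lies in each I j because it is also the component at j. *)
Lemma cech_d_ker0 (c : cech_mod I 0) : cech_d c = 0 -> exists x, cech_aug x = c.
Proof.
move=> dc; have /andP[/forallP cI _] := submod_valP c.
have cE alpha beta : val c alpha = val c beta.
  have := congr1 (fun d : cech_mod I 1 =>
    val d (cons_index (alpha ord0) beta)) dc.
  rewrite /= !ffunE !big_ord_recl big_ord0 omit_cons0 expr0 scale1r scaleN1r.
  rewrite addr0.
  move/eqP; rewrite subr_eq0 => /eqP ->; congr (val c _).
  apply/ffunP=> k; rewrite ord1 [RHS]ffunE -[LHS](cons_index0 _ beta).
  by congr (cons_index _ _ _); apply: val_inj.
have cap : val c [ffun=> ord0] \in bigcapsm I.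
  apply/forallP=> j; rewrite (cE _ [ffun=> j]).
  have /asboolP[y yI ->] := cI [ffun=> j].
  by have := yI ord0; rewrite big_ord1 ffunE.
exists (Submod cap); apply: val_inj; apply/ffunP=> alpha.
by rewrite cech_augE; apply: cE.
Qed.
End Augmentation.

(** A cocycle z on the free cover of M and a cocycle t on M correspond when they
come from one and the same map from M to the intersection of the I_j. *)
Lemma ext_cech_iso0 (R : pzRingType) (A : lmodType R) n
    (I : 'I_n.+1 -> submodClosed A) :
  nat_iso (Ext (submod (bigcapsm I)) 0) (coh_functor (hom_complex (cech I)) 0).
Proof.
pose rel M (z : cocycle (ext_complex (submod (bigcapsm I)) M) 0)
    (t : cocycle (hom_complex (cech I) M) 0) :=
  forall u, cech_aug I ((val z : Defs.hom _ _) u) =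
    (val t : Defs.hom _ _) (free_eval M u).
apply: (@nat_iso_relation _ _ _ 0 rel) =>
    [M z t z' t' zt zt' u|M z|M t|M z t zt|M N f z t zt u].
- by rewrite /= raddfB /= zt zt'.
- have /eqP dz := coc_valP z.
  have [h hE] := factor_linear (@free_eval_surj R M)
    (fun u => @ext_cocycle_ker R (submod (bigcapsm I)) M 0 (val z) u dz).
  pose t : Defs.hom M (cech I 0) := cech_aug I \o h.
  have dt : t \in @cocycle_pred (hom_complex (cech I) M) 0.
    by apply/eqP/homP => x; apply: cech_d_aug.
  by exists (Cocycle dt) => u; rewrite /= hE.
- have /eqP dt := coc_valP t.
  have [h hE] := lift_linear (f := cech_aug I) (g := val t : Defs.hom _ _)
    (@cech_aug_inj _ _ _ I)
    (fun x => cech_d_ker0 (congr1 (fun g : Defs.hom M (cech I 1) => g x) dt)).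
  pose z : Defs.hom (res 0 M) (submod (bigcapsm I)) := h \o free_eval M.
  have dz : z \in @cocycle_pred (ext_complex (submod (bigcapsm I)) M) 0.
    apply/eqP/homP => u; rewrite precompE /= /res_diff /=.
    have /eqP-> := submod_valP (free_eval (syz 1 M) u); exact: raddf0.
  by exists (Cocycle dz) => u; rewrite /= hE.
- split=> /= e0; apply: homP => x.
    have [u <-] := free_eval_surj x.
    by rewrite -zt /= e0 raddf0.
  by apply: (@cech_aug_inj _ _ _ I); rewrite zt /= e0 raddf0.
by rewrite /= zt free_eval_map.
Qed.

(** * Comparison of the two cohomologies *)

Lemma coh_eq0 (X : cochain) q :
  (forall x : X q, cdiff X q x = 0 -> is_coboundary x) ->
  forall u : cohomology X q, u = 0.
Proof.
move=> bnd u; elim/coh_ind: u => z; rewrite -(raddf0 (@coh_class X q)).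
by apply: coh_class_eq; rewrite subr0; apply/bnd/eqP/coc_valP.
Qed.

(** In degree 0 the comparison is [ext_cech_iso0]; in positive degrees both
sides vanish. *)
Theorem corollary4 (R : pzRingType) (A : lmodType R) (n : nat)
    (I : 'I_n.+1 -> submodClosed A)
    (R_noetherian : left_noetherian R)
    (R_hereditary : left_hereditary R)
    (A_distributive : distributive_module A)
    (I_injective : forall j, injective_module (submod (I j))) :
  (forall q : nat,
     nat_iso (Ext (submod (bigcapsm I)) q)
             (coh_functor (hom_complex (cech I)) q)) /\
  (dedekind_ring R -> fin_gen_module A -> nonsingular_module A ->
   forall (q : nat) (M : lmodType R), (0 < q)%N ->
     forall x : coh_functor (hom_complex (cech I)) q M, x = 0%R).
Proof.
have cech0 q (M : lmodType R)
    (u : cohomology (hom_complex (cech I) M) q.+1) : u = 0.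
  apply: coh_eq0 u => g dg.
  apply: (cech_hom_exact A_distributive I_injective) => x.
  exact: (congr1 (fun h : Defs.hom M (cech I q.+2) => h x) dg).
have ext0 q (M : lmodType R)
    (u : cohomology (ext_complex (submod (bigcapsm I)) M) q.+1) : u = 0.
  apply: coh_eq0 u => g dg.
  exact: ext_injective (bigcap_injective A_distributive I_injective) dg.
split=> [[|q]|_ _ _ [|q] M // _ u]; [exact: ext_cech_iso0 | | exact: cech0].
exists (fun M => \0 : {additive _ -> _}); split=> [M|M N f u].
  by exists (fun=> 0) => u; [rewrite [RHS]ext0 | rewrite [RHS]cech0].
by rewrite /= raddf0.
Qed.
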